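(* Let $h\in L^2(\mathbb T^2)$. For every $M=M(C)$, $C\in\mathbb R$, and every $Z=(\Pi,\Gamma)\in\mathcal M(\mathcal T_g)$, $$M(T_hZ)=T_h\,M(Z),$$ i.e. the operations of translation and renormalization commute.
   Context: Notation. Points of $\mathbb R^3=\mathbb R\times\mathbb R^2$ are $z=(t,x)$, with $|z-z'|=\sqrt{|t-t'|}+|x-x'|$; $\varphi_z^\lambda(s,y)=\lambda^{-4}\varphi(\lambda^{-2}(s-t),\lambda^{-1}(y-x))$, $\lambda\in(0,1]$; $\mathcal B$ is the set of $C^2$ functions on $\mathbb R^3$ supported in the unit ball with $C^2$-norm at most $1$. Functions on $\mathbb T^2=(\mathbb R/2\pi\mathbb Z)^2$ are identified with periodic functions on $\mathbb R^2$ and with time-independent functions on $\mathbb R^3$. Regularity structures. Let $\alpha_{\min}=-1-\kappa$ with $\kappa>0$ small. $T_g$ is the real vector space with basis symbols $\Xi,\ \mathcal I(\Xi)\Xi,\ X_i\Xi$ (spanning $T_{\mathcal W}$) and $1,\ \mathcal I(\Xi),\ X_i$ (spanning $T_{\mathcal U}$), $i=1,2$. $T_g^H$ is the real vector space with basis symbols $\sigma,\ \mathcal I(\sigma)\sigma',\ X_i\sigma$ (spanning $T_{\mathcal W^H}$) and $1,\ \mathcal I(\sigma),\ X_i$ (spanning $T_{\mathcal U^H}$), where $\sigma,\sigma'\in\{\Xi,H\}$, $i=1,2$. Homogeneities: $|1|=0$, $|X_i|=1$, $|\Xi|=|H|=\alpha_{\min}$, $|\tau\bar\tau|=|\tau|+|\bar\tau|$,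 $|\mathcal I(\tau)|=|\tau|+2$. Let $S=\{\Xi\}$ for $T_g$ and $S=\{\Xi,H\}$ for $T_g^H$. $T_g^+$ (resp. $(T_g^H)^+$) is the commutative algebra generated by $X_1,X_2,\mathcal J(\sigma)$, $\sigma\in S$. The structure group consists of the maps $\Gamma_f$, with $f$ a multiplicative linear functional on this algebra, given by $\Gamma_f\sigma=\sigma$, $\Gamma_f1=1$, $\Gamma_fX_i=X_i+f(X_i)1$, $\Gamma_f\mathcal I(\sigma)=\mathcal I(\sigma)+f(\mathcal J(\sigma))1$, $\Gamma_f(\tau\sigma)=(\Gamma_f\tau)\sigma$. The resulting regularity structures are $\mathcal T_g$ and $\mathcal T_g^H$. Kernel. The heat kernel on $\mathbb R\times\mathbb R^2$ is written $\bar K=K+K_{sm}$ with $K_{sm}$ smooth and $K$ supported in $\{|x|^2+t\le1\}$, symmetric in $x$, zero for $t\le0$, equal to $\frac1{4\pi t}e^{-|x|^2/(4t)}$ for $t>0$, $|x|^2+t<\frac12$, smooth on $\{|x|^2+t\ge\frac14\}$, and annihilating polynomials of parabolic degree less than $3$. Admissible models. An admissible model on $\mathcal T_g$ (resp. $\mathcal T_g^H$), with $T=T_g$ (resp. $T_g^H$), is a pair $Z=(\Pi,\Gamma)$, also written $(\Pi,f)$, where $\Pi:\mathbb R^3\to\mathcal L(T,\mathcal S'(\mathbb R^3))$, $\Gamma_{zz'}=(\Gamma_{f_z})^{-1}\Gamma_{f_{z'}}$, $\Pi_z\Gamma_{zz'}=\Pi_{z'}$; for each compact $D$, $|\langle\Pi_z\tau,\varphi_z^\lambda\rangle|\lesssim\lambda^{|\tau|}$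 and $\|\Gamma_{zz'}\tau\|_m\lesssim|z-z'|^{|\tau|-m}$ uniformly over basis symbols $\tau$, homogeneities $m<|\tau|$, $z,z'\in D$, $\varphi\in\mathcal B$, $\lambda\in(0,1]$ ($\|\cdot\|_m$ is the norm of the component of homogeneity $m$); and, for $z=(t,x)$, $\sigma\in S$: $\Pi_z1=1$, $\Pi_zX_i=(\cdot-x)_i$, $\Pi_z(X_i\sigma)=(\cdot-x)_i\,\Pi_z\sigma$, $\Pi_z\mathcal I(\sigma)(w)=\langle\Pi_z\sigma,K(w-\cdot)\rangle+f_z(\mathcal J(\sigma))$, with $f_z(X_i)=-x_i$ and $f_z(\mathcal J(\sigma))=-\langle\Pi_z\sigma,K(z-\cdot)\rangle$. All models are $2\pi$-periodic in space. A model is smooth if $z\mapsto\Pi_z$ is a smooth map with values in $\mathcal L(T,C^\infty(\mathbb R^3))$. $\mathcal M(\mathcal T)$ is the closure of the smooth admissible models on $\mathcal T$ under the semidistances $\sup_{z\in D}\sup_{\varphi\in\mathcal B}\sup_{\lambda\in(0,1]}\sup_\tau\lambda^{-|\tau|}|\langle\Pi_z\tau-\bar\Pi_z\tau,\varphi_z^\lambda\rangle|$, where $\tau$ runs over basis symbols and $D=I\times\mathbb T^2$ with $I$ a compact interval. Extension and translation. For $Z=(\Pi,f)\in\mathcal M(\mathcal T_g)$ and $h\in L^2(\mathbb T^2)$, $E_hZ=(\Pi^{e_h},f^{e_h})\in\mathcal M(\mathcal T_g^H)$ is the unique admissible model on $\mathcal T_g^H$ that agrees with $Z$ on $T_g$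 and $T_g^+$, with $\Pi_z^{e_h}H=h$ and $\Pi_z^{e_h}(\tau_1\sigma)=(\Pi_z^{e_h}\tau_1)(\Pi_z^{e_h}\sigma)$ for all basis symbols $\tau_1\sigma\in T_g^H\setminus T_g$ of negative homogeneity with $\tau_1\in T_{\mathcal U^H}$, $\sigma\in\{\Xi,H\}$ (product understood as continuous extension of the pointwise product to the Hölder--Sobolev setting). $T_hZ=(\Pi^{e_h}\tau_H,f^{e_h}\tau_H^+)\in\mathcal M(\mathcal T_g)$, where $\tau_H:T_g\to T_g^H$ is linear, multiplicative, commutes with $\mathcal I$, leaves $1,X_i$ invariant and $\tau_H(\Xi)=\Xi+H$; $\tau_H^+:T_g^+\to(T_g^H)^+$ is linear, multiplicative, leaves $X_i$ invariant and $\tau_H^+(\mathcal J(\Xi))=\mathcal J(\Xi)+\mathcal J(H)$. Renormalization maps. For $C\in\mathbb R$, $M=M(C)$ is the linear map on $T_{\mathcal W}\oplus\langle1\rangle$ with $M(\mathcal I(\Xi)\Xi)=\mathcal I(\Xi)\Xi-C\,1$ and $M\tau=\tau$ for the other basis symbols. For $Z=(\Pi,\Gamma)\in\mathcal M(\mathcal T_g)$, $M(Z)$ is the unique element of $\mathcal M(\mathcal T_g)$ given on $T_{\mathcal W}\oplus\langle1\rangle$ by $\Pi_z^M\tau=\Pi_zM\tau$, $\Gamma^M_{zz'}\tau=\Gamma_{zz'}\tau$. *)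

(* Defs.v *)
From HB Require Import structures.
From mathcomp Require Import all_boot all_order all_algebra.
From mathcomp Require Import all_classical all_reals all_analysis.

Set Implicit Arguments.
Unset Strict Implicit.
Unset Printing Implicit Defensive.

Import Order.TTheory GRing.Theory Num.Theory.
Import numFieldNormedType.Exports.

Local Open Scope classical_set_scope.
Local Open Scope ring_scope.

(* Partial functions given by a definite description. *)
Definition the (T : Type) (P : T -> Prop) : option T :=
  if pselect (exists! x, P x) is left e then Some (projT1 (cid e)) else None.

(** * Functions on space-time *)

Definition plane (R : realType) : Type := (R * R)%type.
(* z = (t, x) is z.1, z.2 with x = (z.2.1, z.2.2). *)
Definition spacetime (R : realType) : Type := (R * (R * R))%type.

Section Functions.
Context {R : realType}.

(* Coordinate-free form of "all partial derivatives up to order k exist and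
   are continuous"; used for V = R^2, R^3 and R^3 * R^3. *)
Fixpoint Ck (V : normedModType R) (k : nat) (f : V -> R) : Prop :=
  continuous f /\
  (if k is k'.+1 then
     forall v : V, (forall z, derivable f z v) /\ Ck k' (fun z => 'D_v f z)
   else True).

Definition smooth (V : normedModType R) (f : V -> R) : Prop :=
  forall k, Ck k f.

Definition iterD (V : normedModType R) (vs : seq V) (f : V -> R) : V -> R :=
  foldr (fun v g => fun z => 'D_v g z) f vs.

Definition dir2 (i : 'I_2) : R * R := ((i == 0 :> nat)%:R, (i == 1 :> nat)%:R).
Definition dir3 (i : 'I_3) : R * (R * R) :=
  ((i == 0 :> nat)%:R, ((i == 1 :> nat)%:R, (i == 2 :> nat)%:R)).

(* A multi-index is the list of the directions of differentiation. *)
Definition partial2 (l : seq 'I_2) (f : plane R -> R) : plane R -> R :=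
  @iterD (R * R)%type (map dir2 l) f.
Definition partial3 (l : seq 'I_3) (f : spacetime R -> R) : spacetime R -> R :=
  @iterD (R * (R * R))%type (map dir3 l) f.

Definition smooth2 (f : plane R -> R) : Prop := @smooth (R * R)%type f.
Definition smooth3 (f : spacetime R -> R) : Prop := @smooth (R * (R * R))%type f.
Definition smooth33 (f : spacetime R * spacetime R -> R) : Prop :=
  @smooth ((R * (R * R)) * (R * (R * R)))%type f.

Definition addp (z w : spacetime R) : spacetime R :=
  (z.1 + w.1, (z.2.1 + w.2.1, z.2.2 + w.2.2)).
Definition subp (z w : spacetime R) : spacetime R :=
  (z.1 - w.1, (z.2.1 - w.2.1, z.2.2 - w.2.2)).
Definition xcoord (i : 'I_2) (z : spacetime R) : R :=
  if i == 0 :> nat then z.2.1 else z.2.2.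
Definition xsq (z : spacetime R) : R := z.2.1 ^+ 2 + z.2.2 ^+ 2.
Definition parabolic (z : spacetime R) : R := Num.sqrt `|z.1| + Num.sqrt (xsq z).

Definition supported_in (f : spacetime R -> R) (r : R) : Prop :=
  forall z, f z != 0 -> parabolic z <= r.

Local Notation mR := (measurableTypeR R).
Local Notation leb := (@lebesgue_measure R).
Definition mu2 : {measure set (mR * mR)%type -> \bar R} := (leb \x leb)%E.
Definition mu3 : {measure set (mR * (mR * mR))%type -> \bar R} := (leb \x^ mu2)%E.
Definition integral3 (f : spacetime R -> R) : R := \int[mu3]_z f z.

(* phi_z^lambda *)
Definition rescale (z : spacetime R) (lam : R) (phi : spacetime R -> R) : spacetime R -> R :=
  fun w => lam ^- 4 *
    phi (lam ^- 2 * (w.1 - z.1),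
         (lam^-1 * (w.2.1 - z.2.1), lam^-1 * (w.2.2 - z.2.2))).

Definition in_B (phi : spacetime R -> R) : Prop :=
  [/\ @Ck (R * (R * R))%type 2 phi, supported_in phi 1 &
      forall l z, (size l <= 2)%N -> `|partial3 l phi z| <= 1].

(** * Distributions *)

Definition test (phi : spacetime R -> R) : Prop :=
  smooth3 phi /\ exists r, supported_in phi r.

(* The dual of the space of smooth compactly supported functions.  The
   functional is defined on all functions, with the value 0 outside that
   space, so that equality of distributions is Leibniz equality. *)
Record distribution := Distribution {
  pair_dist :> (spacetime R -> R) -> R;
  _ : forall a phi psi, test phi -> test psi ->
      pair_dist (fun z => a * phi z + psi z) = a * pair_dist phi + pair_dist psi;
  _ : forall phi, ~ test phi -> pair_dist phi = 0;
  _ : forall r, exists C : R, exists N : nat, forall phi b,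
      test phi -> supported_in phi r ->
      (forall l z, (size l <= N)%N -> `|partial3 l phi z| <= b) ->
      `|pair_dist phi| <= C * b }.

Definition C2_cvg (psi_ : nat -> spacetime R -> R) (psi : spacetime R -> R) : Prop :=
  (exists r, forall n, supported_in (psi_ n) r) /\
  forall eps, 0 < eps -> exists N, forall n l z, (N <= n)%N -> (size l <= 2)%N ->
    `|partial3 l (psi_ n) z - partial3 l psi z| <= eps.

(* The value at a compactly supported C^2 function psi of the extension by
   continuity of the functional L. *)
Definition pairs_C2 (L : (spacetime R -> R) -> R) (psi : spacetime R -> R) (a : R) : Prop :=
  forall psi_ : nat -> spacetime R -> R, (forall n, test (psi_ n)) ->
    C2_cvg psi_ psi -> L (psi_ n) @[n --> \oo] --> a.

(* L = O(lambda^a) at z with constant c, uniformly over the test functions *)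
Definition scaling_bound (L : (spacetime R -> R) -> R) (z : spacetime R) (a c : R) : Prop :=
  forall phi lam, in_B phi -> 0 < lam <= 1 ->
    exists2 v, pairs_C2 L (rescale z lam phi) v & `|v| <= c * lam `^ a.

(** * Product of a Hoelder and a Sobolev distribution *)

Definition L2box : set (plane R) := `[0, 2 * pi]%classic `*` `[0, 2 * pi]%classic.

Definition periodic2 (g : plane R -> R) : Prop :=
  forall x1 x2, g (x1 + 2 * pi, x2) = g (x1, x2) /\ g (x1, x2 + 2 * pi) = g (x1, x2).

(* Representatives of elements of L^2(T^2). *)
Definition L2_torus (h : plane R -> R) : Prop :=
  [/\ measurable_fun setT h, periodic2 h &
      (\int[mu2]_(x in L2box) ((h x) ^+ 2)%:E < +oo)%E].

(* The local seminorms of C^a, a < 1, on the parabolic ball of radius r. *)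
Definition holder_le (a r c : R) (u : spacetime R -> R) : Prop :=
  if 0 < a then
    (forall z, parabolic z <= r -> `|u z| <= c) /\
    (forall z w, parabolic z <= r -> parabolic w <= r ->
       `|u z - u w| <= c * parabolic (subp z w) `^ a)
  else
    forall z phi lam, parabolic z <= r -> in_B phi -> 0 < lam <= 1 ->
      `|integral3 (fun w => u w * rescale z lam phi w)| <= c * lam `^ a.

(* The H^b(T^2) seminorms. *)
Definition sobolev_le (b : nat) (c : R) (g : plane R -> R) : Prop :=
  forall l, (size l <= b)%N ->
    (\int[mu2]_(x in L2box) ((partial2 l g x) ^+ 2)%:E <= c%:E)%E.

(* Smooth functions u_ n converging to the distribution u in C^a_loc, i.e.
   converging to u weakly and Cauchy in C^a_loc; similarly for H^b. *)
Definition holder_cvg (a : R) (u_ : nat -> spacetime R -> R) (u : distribution) : Prop :=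
  [/\ forall n, smooth3 (u_ n),
      forall phi, test phi -> integral3 (fun z => u_ n z * phi z) @[n --> \oo] --> u phi &
      forall r eps, 0 < eps -> exists N, forall n m, (N <= n)%N -> (N <= m)%N ->
        holder_le a r eps (fun z => u_ n z - u_ m z)].

Definition sobolev_cvg (b : nat) (g_ : nat -> plane R -> R) (g : distribution) : Prop :=
  [/\ forall n, smooth2 (g_ n) /\ periodic2 (g_ n),
      forall phi, test phi -> integral3 (fun z => g_ n z.2 * phi z) @[n --> \oo] --> g phi &
      forall eps, 0 < eps -> exists N, forall n m, (N <= n)%N -> (N <= m)%N ->
        sobolev_le b eps (fun x => g_ n x - g_ m x)].

(* p is the value at (u, g) of the extension by continuity of the pointwise
   product of smooth functions to C^a_loc x H^b(T^2) (a + b > 0). *)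
Definition is_product (a : R) (b : nat) (u g p : distribution) : Prop :=
  (exists u_ g_, holder_cvg a u_ u /\ sobolev_cvg b g_ g) /\
  forall u_ g_, holder_cvg a u_ u -> sobolev_cvg b g_ g ->
    forall phi, test phi ->
      integral3 (fun z => u_ n z * g_ n z.2 * phi z) @[n --> \oo] --> p phi.

(** * The kernel *)

Definition heat (z : spacetime R) : R :=
  if 0 < z.1 then (4 * pi * z.1)^-1 * expR (- (xsq z / (4 * z.1))) else 0.

Record is_kernel (K : spacetime R -> R) : Prop := IsKernel {
  kernel_heat : exists2 Ksm, smooth3 Ksm & forall z, heat z = K z + Ksm z;
  kernel_supp : forall z, K z != 0 -> xsq z + z.1 <= 1;
  kernel_sym : forall t x1 x2, K (t, (- x1, - x2)) = K (t, (x1, x2));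
  kernel_past : forall z, z.1 <= 0 -> K z = 0;
  kernel_near0 : forall z, 0 < z.1 -> xsq z + z.1 < 2^-1 ->
    K z = (4 * pi * z.1)^-1 * expR (- (xsq z / (4 * z.1)));
  kernel_smooth : exists2 k, smooth3 k & forall z, 4^-1 <= xsq z + z.1 -> K z = k z;
  kernel_poly : forall i j k : nat, (2 * i + j + k < 3)%N ->
    integral3 (fun z => K z * (z.1 ^+ i * z.2.1 ^+ j * z.2.2 ^+ k)) = 0 }.

Definition is_cutoff (chi : spacetime R -> R) : Prop :=
  [/\ smooth3 chi,
      exists2 r, 0 < r & forall z, parabolic z < r -> chi z = 0 &
      forall z, 1 <= parabolic z -> chi z = 1].

(* K is singular at 0; truncK K chi n is smooth, and equal to K outside the
   parabolic ball of radius 2^-n. *)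
Definition truncK (K chi : spacetime R -> R) (n : nat) (z : spacetime R) : R :=
  K z * chi (4 ^+ n * z.1, (2 ^+ n * z.2.1, 2 ^+ n * z.2.2)).

(* a = <xi, K(w - .)>; the limit does not depend on the cutoff chi. *)
Definition pairs_K (K chi : spacetime R -> R) (xi : distribution) (w : spacetime R) (a : R) : Prop :=
  xi (fun y => truncK K chi n (subp w y)) @[n --> \oo] --> a.

(* The test function y |-> \int K(w - y) phi(w) dw, so that the convolution
   K * xi is phi |-> xi (adjK K phi). *)
Definition adjK (K : spacetime R -> R) (phi : spacetime R -> R) : spacetime R -> R :=
  fun y => integral3 (fun w => K (subp w y) * phi w).

End Functions.

Arguments distribution : clear implicits.

(** * The regularity structures *)

Inductive noise1 := Xi.
Inductive noise2 := Xi2 | H2.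

Definition noise1_code (s : noise1) : unit := tt.
Definition noise1_decode (u : unit) : noise1 := Xi.
Lemma noise1_codeK : cancel noise1_code noise1_decode. Proof. by case. Qed.
HB.instance Definition _ := Finite.copy noise1 (can_type noise1_codeK).

Definition noise2_code (s : noise2) : bool := if s is Xi2 then false else true.
Definition noise2_decode (b : bool) : noise2 := if b then H2 else Xi2.
Lemma noise2_codeK : cancel noise2_code noise2_decode. Proof. by case. Qed.
HB.instance Definition _ := Finite.copy noise2 (can_type noise2_codeK).

(* The basis symbols 1, X_i, I(s) of T_U. *)
Inductive usymb (S : Type) := UOne | UX of 'I_2 | UI of S.
Arguments UOne {S}.
Arguments UX {S}.

Definition usymb_code (S : Type) (u : usymb S) : unit + ('I_2 + S) :=
  match u with UOne => inl tt | UX i => inr (inl i) | UI s => inr (inr s) end.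
Definition usymb_decode (S : Type) (c : unit + ('I_2 + S)) : usymb S :=
  match c with inl _ => UOne | inr (inl i) => UX i | inr (inr s) => UI s end.
Lemma usymb_codeK S : cancel (@usymb_code S) (@usymb_decode S).
Proof. by case. Qed.
HB.instance Definition _ (S : finType) :=
  Finite.copy (usymb S) (can_type (@usymb_codeK S)).

(* (u, None) is the symbol u of T_U and (u, Some s) is the symbol u s of T_W;
   in particular (UOne, Some s) is the noise s itself.  S = noise1 gives T_g
   and S = noise2 gives T_g^H. *)
Definition symb (S : Type) : Type := (usymb S * option S)%type.

(* The generators X_i and J(s) of T^+.  A multiplicative functional on this
   free commutative algebra is given by its values on the generators. *)
Inductive gen (S : Type) := GX of 'I_2 | GJ of S.
Arguments GX {S}.

Section RegularityStructure.
Context {R : realType}.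

Definition tspace (S : finType) : Type :=
  {ffun (usymb S * option S)%type -> R^o}.

Section OneStructure.
Context {S : finType}.

Definition alpha_min (kappa : R) : R := -1 - kappa.

Definition homu (kappa : R) (u : usymb S) : R :=
  match u with UOne => 0 | UX _ => 1 | UI _ => alpha_min kappa + 2 end.
Definition hom (kappa : R) (s : symb S) : R :=
  homu kappa s.1 + (if s.2 is Some _ then alpha_min kappa else 0).

Definition e_ (s : symb S) : tspace S := [ffun s' => (s' == s)%:R].

End OneStructure.

Definition extend_lin (S S' : finType) (b : symb S -> tspace S') :
    'Hom(tspace S, tspace S') :=
  linfun (fun t : tspace S => \sum_s (t s *: b s : tspace S')).

Definition character (S : finType) : Type := gen S -> R.

Definition char_u (S : finType) (f : character S) (u : usymb S) : R :=
  match u with UOne => 0 | UX i => f (GX i) | UI s => f (GJ s) end.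

(* Gamma_f (u s) = (Gamma_f u) s, Gamma_f u = u + f(u) 1 *)
Definition Gamma_ (S : finType) (f : character S) :=
  extend_lin (fun s : symb S => e_ s + char_u f s.1 *: e_ (UOne, s.2)).

(** * Models *)

(* A model (Pi, f); Gamma is derived from f below. *)
Record model (S : finType) := Model {
  Pi : spacetime R -> tspace S -> distribution R;
  chr : spacetime R -> character S }.

Definition Gam (S : finType) (Z : model S) (z z' : spacetime R) :=
  ((Gamma_ (chr Z z))^-1 \o Gamma_ (chr Z z'))%VF.

Definition comp_norm (S : finType) (kappa m : R) (t : tspace S) : R :=
  \sum_(s : symb S | hom kappa s == m) `|t s : R|.

Record is_model (S : finType) (kappa : R) (Z : model S) : Prop := IsModel {
  Pi_linear : forall z (a : R) (t t' : tspace S) phi,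
    Pi Z z (a *: t + t') phi = a * Pi Z z t phi + Pi Z z t' phi;
  Pi_Gam : forall z z' t, Pi Z z (Gam Z z z' t) = Pi Z z' t;
  Pi_bound : forall D : set (spacetime R), @compact (R * (R * R))%type D ->
    exists c, forall z s, D z -> scaling_bound (Pi Z z (e_ s)) z (hom kappa s) c;
  Gam_bound : forall D : set (spacetime R), @compact (R * (R * R))%type D ->
    exists c, forall z z' (s s' : symb S), D z -> D z' -> hom kappa s' < hom kappa s ->
      comp_norm kappa (hom kappa s') (Gam Z z z' (e_ s)) <=
        c * parabolic (subp z z') `^ (hom kappa s - hom kappa s') }.

(* 2 pi times the i-th unit vector of space *)
Definition period (i : 'I_2) : spacetime R :=
  (0, (2 * pi * (i == 0 :> nat)%:R, 2 * pi * (i == 1 :> nat)%:R)).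

Record is_periodic (S : finType) (Z : model S) : Prop := IsPeriodic {
  Pi_periodic : forall z t i phi, test phi ->
    Pi Z (addp z (period i)) t (fun w => phi (subp w (period i))) = Pi Z z t phi;
  Gam_periodic : forall z z' i,
    Gam Z (addp z (period i)) (addp z' (period i)) = Gam Z z z' }.

Record is_admissible (S : finType) (kappa : R) (K chi : spacetime R -> R)
    (Z : model S) : Prop := IsAdmissible {
  adm_model : is_model kappa Z;
  adm_periodic : is_periodic Z;
  adm_One : forall z phi, test phi -> Pi Z z (e_ (UOne, None)) phi = integral3 phi;
  adm_X : forall z i phi, test phi -> Pi Z z (e_ (UX i, None)) phi =
    integral3 (fun w => (xcoord i w - xcoord i z) * phi w);
  adm_XS : forall z i s phi, test phi -> Pi Z z (e_ (UX i, Some s)) phi =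
    Pi Z z (e_ (UOne, Some s)) (fun w => (xcoord i w - xcoord i z) * phi w);
  adm_I : forall z s phi, test phi -> Pi Z z (e_ (UI s, None)) phi =
    Pi Z z (e_ (UOne, Some s)) (adjK K phi) + chr Z z (GJ s) * integral3 phi;
  adm_chrX : forall z i, chr Z z (GX i) = - xcoord i z;
  adm_chrJ : forall z s,
    pairs_K K chi (Pi Z z (e_ (UOne, Some s))) z (- chr Z z (GJ s)) }.

(* z |-> Pi_z is a smooth map into L(T, C^oo(R^3)) when Pi_z s is a smooth
   function F(z, .) with F jointly smooth on R^3 x R^3. *)
Definition is_smooth_model (S : finType) (Z : model S) : Prop :=
  forall s : symb S, exists2 F : spacetime R * spacetime R -> R, smooth33 F &
    forall z phi, test phi -> Pi Z z (e_ s) phi = integral3 (fun w => F (z, w) * phi w).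

(* The closure of the smooth admissible models. *)
Definition model_space (S : finType) (kappa : R) (K chi : spacetime R -> R)
    (Z : model S) : Prop :=
  is_admissible kappa K chi Z /\
  forall (a b eps : R), 0 < eps -> exists Z' : model S,
    [/\ is_admissible kappa K chi Z', is_smooth_model Z' &
        forall z s, a <= z.1 <= b ->
          scaling_bound (fun phi => Pi Z z (e_ s) phi - Pi Z' z (e_ s) phi)
            z (hom kappa s) eps].

(** * Extension, translation and renormalization *)

Definition incl_u (u : usymb noise1) : usymb noise2 :=
  match u with UOne => UOne | UX i => UX i | UI _ => UI Xi2 end.
Definition incl_symb (s : symb noise1) : symb noise2 :=
  (incl_u s.1, omap (fun=> Xi2) s.2).
Definition incl := extend_lin (fun s => e_ (incl_symb s)).

(* The Hoelder and Sobolev factors in the products u s with s = H, and in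
   I(H) Xi: in the former, u is in C^(alpha_min + 2) and H = h in L^2; in the
   latter, Xi is in C^alpha_min and I(H) = K * h - const in H^2. *)
Definition extension_product (kappa : R) (z : spacetime R) (Z : model noise2)
    (u : usymb noise2) (s : noise2) : Prop :=
  let p := Pi Z z (e_ (u, Some s)) in
  let pu := Pi Z z (e_ (u, None)) in
  let ps := Pi Z z (e_ (UOne, Some s)) in
  match s with
  | H2 => is_product (alpha_min kappa + 2) 0 pu ps p
  | Xi2 => is_product (alpha_min kappa) 2 ps pu p
  end.

(* ZE = E_h Z *)
Record is_extension (kappa : R) (K chi : spacetime R -> R) (h : plane R -> R)
    (Z : model noise1) (ZE : model noise2) : Prop := IsExtension {
  ext_space : model_space kappa K chi ZE;
  ext_Pi : forall z t, Pi ZE z (incl t) = Pi Z z t;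
  ext_chrX : forall z i, chr ZE z (GX i) = chr Z z (GX i);
  ext_chrJ : forall z, chr ZE z (GJ Xi2) = chr Z z (GJ Xi);
  ext_H : forall z phi, test phi ->
    Pi ZE z (e_ (UOne, Some H2)) phi = integral3 (fun w => h w.2 * phi w);
  ext_product : forall z u s, hom kappa (u, Some s) < 0 ->
    (u, Some s) \notin codom incl_symb -> extension_product kappa z ZE u s }.

Definition extension kappa K chi h Z : option (model noise2) :=
  the (is_extension kappa K chi h Z).

Definition tauH_u (u : usymb noise1) : seq (usymb noise2) :=
  match u with UOne => [:: UOne] | UX i => [:: UX i] | UI _ => [:: UI Xi2; UI H2] end.
Definition tauH_s (s : option noise1) : seq (option noise2) :=
  if s is Some _ then [:: Some Xi2; Some H2] else [:: None].
(* tau_H : T_g -> T_g^H *)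
Definition tauH :=
  extend_lin (fun s : symb noise1 =>
    \sum_(u <- tauH_u s.1) \sum_(o <- tauH_s s.2) (e_ (u, o) : tspace noise2)).

(* f tau_H^+ *)
Definition char_tauH (f : character noise2) : character noise1 :=
  fun g => match g with GX i => f (GX i) | GJ _ => f (GJ Xi2) + f (GJ H2) end.

(* T_h Z *)
Definition translation kappa K chi h Z : option (model noise1) :=
  omap (fun ZE => Model (fun z t => Pi ZE z (tauH t)) (fun z => char_tauH (chr ZE z)))
    (extension kappa K chi h Z).

Definition in_W1 (s : symb noise1) : bool := (s.2 != None) || (s == (UOne, None)).

(* M(C), extended by the identity from T_W + <1> to T_g. *)
Definition Mren (C : R) :=
  extend_lin (fun s : symb noise1 =>
    if s == (UI Xi, Some Xi) then e_ s - C *: e_ (UOne, None) else e_ s).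

Record is_renormalization (kappa : R) (K chi : spacetime R -> R) (C : R)
    (Z ZM : model noise1) : Prop := IsRenormalization {
  ren_space : model_space kappa K chi ZM;
  ren_Pi : forall z s, in_W1 s -> Pi ZM z (e_ s) = Pi Z z (Mren C (e_ s));
  ren_Gam : forall z z' s, in_W1 s -> Gam ZM z z' (e_ s) = Gam Z z z' (e_ s) }.

(* M(Z) for M = M(C) *)
Definition renormalization kappa K chi C Z : option (model noise1) :=
  the (is_renormalization kappa K chi C Z).

End RegularityStructure.

(* Main.v *)
From HB Require Import structures.
Require Import Defs.
From mathcomp Require Import all_boot all_order all_algebra.
From mathcomp Require Import all_classical all_reals all_analysis.
From mathcomp Require Import measurable_realfun lra.

(** Translation and renormalization are both precomposition with a linear map
    between the two spaces of symbols.  Call noise substitution a map that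
    replaces each noise s by a sum of noises nu s, extends this multiplicatively
    to the symbols u s and I(s), and adds a counterterm c a b 1 to the image of
    I(a) b.  The map tau_H is the substitution Xi := Xi + H without counterterm,
    the inclusion of T_g in T_g^H is Xi := Xi, and M(C) is the identity
    substitution with the counterterm - C at I(Xi) Xi.

    Three facts then give the result.

    - Pulling back along a noise substitution preserves the space of models
      ([subst_model_space]).  A substitution intertwines the structure groups
      ([noise_map_Gam]) and never lowers homogeneities ([hom_noise_map]): it
      preserves them, except that the counterterm sends I(a) b, of homogeneity
      - 2 kappa < 0, to 1.  All analytic conditions are linear in the symbol and
      hence survive; linearity of the smooth realization uses that continuous
      functions of compact support are integrable ([integral3_lin]).  In
      particular M(Z) exists, and it is the pullback ([renormalizationE]).

    - Noise substitutions compose ([noise_map_comp]).  Let M' be the map that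
      subtracts C at I(Xi) Xi in T_g^H.  Both M' tau_H and tau_H M substitute
      Xi + H for Xi with counterterm - C, since Xi occurs once in Xi + H; so
      M' tau_H = tau_H M ([ren_H_tauH]).  Likewise M' commutes with the inclusion
      of T_g, and M(- C) inverts M(C).

    - The extension of a model, when it exists, is unique
      ([is_extension_unique]), because an admissible model is determined by its
      values on the noises and on the symbols I(a) b ([admissible_eq]).  Moreover
      M' maps extensions of Z to extensions of M(Z) ([ren_H_extension]): only the
      symbol I(Xi) Xi of T_g changes, so the products that define the extension
      are the same.

    Write Y A for the pullback of a model Y along A.  If E_h Z exists, then
    E_h M(Z) = (E_h Z) M', so T_h M(Z) = (E_h Z) M' tau_H = (E_h Z) tau_H M =
    M(T_h Z); here M applies to T_h Z because T_h Z = (E_h Z) tau_H is again in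
    the space of models.  If E_h Z does not exist then neither does E_h M(Z), for
    otherwise renormalization with - C would turn it into an extension of Z; both
    sides are then undefined. *)

Set Implicit Arguments.
Unset Strict Implicit.
Unset Printing Implicit Defensive.

Import Order.TTheory GRing.Theory Num.Theory.
Import numFieldNormedType.Exports.

Local Open Scope classical_set_scope.
Local Open Scope ring_scope.

(** * Definite descriptions *)

Lemma the_eq_Some (T : Type) (P : T -> Prop) x :
  P x -> (forall y y', P y -> P y' -> y = y') -> the P = Some x.
Proof.
move=> Px uniP; rewrite /the; case: pselect => [e|[]]; last first.
  by exists x; split => // y; exact: uniP.
by case: (cid e) => y [Py _] /=; congr Some; exact: uniP.
Qed.

Lemma the_eq_None (T : Type) (P : T -> Prop) : (forall x, ~ P x) -> the P = None.
Proof.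
move=> nP; rewrite /the; case: pselect => // e.
by exfalso; case: e => x [/nP].
Qed.

(** * Smooth functions and integrals on space-time *)

Section Analysis.
Context {R : realType}.
Implicit Types (z w : spacetime R) (phi : spacetime R -> R).

Lemma Ck_lin (V : normedModType R) k (a : R) (f g : V -> R) :
  Ck k f -> Ck k g -> Ck k (fun x => a * f x + g x).
Proof.
elim: k f g => [|k IH] f g /= [cf df] [cg dg]; split.
- by move=> x; apply: cvgD; [apply: cvgM; [exact: cvg_cst|exact: cf]|exact: cg].
- by [].
- by move=> x; apply: cvgD; [apply: cvgM; [exact: cvg_cst|exact: cf]|exact: cg].
move=> v; have [df1 df2] := df v; have [dg1 dg2] := dg v; split.
  by move=> y; apply: derivableD => //; exact: derivableZ.
have -> : (fun y => 'D_v (fun x => a * f x + g x) y) =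
          (fun y => a * 'D_v f y + 'D_v g y).
  apply/funext => y.
  have -> : (fun x => a * f x + g x) = (a *: f : V -> R) + g by [].
  by rewrite deriveD// ?deriveZ//; exact: derivableZ.
exact: IH.
Qed.

Local Notation mR := (measurableTypeR R).
Local Notation mR3 := (mR * (mR * mR))%type.
Local Notation R3 := (R * (R * R))%type.

Definition continuous3 (f : spacetime R -> R) : Prop :=
  continuous (f : R3 -> R).

(** The measurable sets of R^3 are those of the iterated product sigma-algebra;
    an open set belongs to it because it is the union of the countably many
    balls with rational centre and radius 1/(n+1) that it contains, and balls
    for the sup norm are products of intervals. *)
Lemma open_measurable3 (U : set mR3) : @open R3 U -> measurable U.
Proof.
move=> oU.
pose pt (q : rat * (rat * rat)) : R3 :=
  (ratr q.1, (ratr q.2.1, ratr q.2.2)).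
pose B (i : rat * (rat * rat) * nat) : set R3 :=
  ball (pt i.1) (i.2.+1%:R^-1 : R).
have -> : U = \bigcup_i (if `[< B i `<=` U >] then B i else set0).
  apply/seteqP; split => [z Uz|z [i _]]; last first.
    by case: asboolP => // + Bz; exact.
  have /nbhs_ballP[e /= e0 eU] : nbhs z U by apply: open_nbhs_nbhs; split.
  (* A radius below e / 2 keeps a ball around a nearby rational point that
     contains z inside the ball of radius e around z. *)
  have [n ne] : exists n : nat, n.+1%:R^-1 < e / 2.
    have [n _ /(_ n (leqnn n)) ?] :=
      near_infty_natSinv_lt (PosNum (divr_gt0 e0 (ltr0Sn _ 1))).
    by exists n.
  have n0 : 0 < n.+1%:R^-1 :> R by rewrite invr_gt0.
  have dr (x : R) : exists q : rat, `|ratr q - x| < n.+1%:R^-1.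
    have : x - n.+1%:R^-1 < x + n.+1%:R^-1.
      by rewrite ltrBlDr -addrA ltrDl addr_gt0.
    move=> /rat_in_itvoo[q]; rewrite in_itv/= => qx.
    by exists q; rewrite ltr_distl.
  have [q1 H1] := dr z.1; have [q2 H2] := dr z.2.1; have [q3 H3] := dr z.2.2.
  have Bz : B ((q1, (q2, q3)), n) z by split => //=.
  exists ((q1, (q2, q3)), n) => //=; case: asboolP => // -[].
  move=> w Bw; apply: eU.
  have := ball_triangle (ball_sym Bz) Bw.
  by apply: le_ball; rewrite /= (splitr e) lerD// ltW.
apply: countable_bigcupT_measurable; first exact: countableP.
move=> i; case: asboolP => // _.
have bE : B i = ball (pt i.1).1 (i.2.+1%:R^-1 : R) `*`
  (ball (pt i.1).2.1 (i.2.+1%:R^-1 : R) `*` ball (pt i.1).2.2 (i.2.+1%:R^-1 : R)).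
  by [].
rewrite bE; apply: measurableX; last apply: measurableX;
  exact: measurable_ball.
Qed.

Lemma continuous_measurable3 (f : mR3 -> R) :
  continuous3 f -> measurable_fun setT f.
Proof.
move=> cf; apply: (measurability _ (RGenOInfty.measurableE R)).
move=> /= _ [_ [a ->]] <-; apply: measurableI => //; apply: open_measurable3.
apply: open_comp => // x _; exact: cf.
Qed.

Definition box (r : R) : set R3 := `[-r, r] `*` (`[-r, r] `*` `[-r, r]).

(** The parabolic distance bounds |t| by r^2 and |x| by r, so that the sum of
    the two bounds serves for all coordinates. *)
Lemma supported_in_box phi r : supported_in phi r ->
  exists r', forall z, phi z != 0 -> box r' z.
Proof.
move=> s; exists (`|r| + r ^+ 2) => z /s pz.
have sq0 : 0 <= Num.sqrt `|z.1| by exact: sqrtr_ge0.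
have sx0 : 0 <= Num.sqrt (xsq z) by exact: sqrtr_ge0.
have xsq0 : 0 <= xsq z by rewrite addr_ge0// sqr_ge0.
have r0 : 0 <= r by apply: le_trans pz; rewrite addr_ge0.
have t1 : `|z.1| <= r ^+ 2.
  rewrite -[leLHS]sqr_sqrtr// ler_pXn2r ?nnegrE//.
  by apply: le_trans pz; rewrite lerDl.
have t2 : Num.sqrt (xsq z) <= r by apply: le_trans pz; rewrite lerDr.
have aux (y : R) : y ^+ 2 <= xsq z -> `|y| <= r.
  by move=> yz; rewrite -sqrtr_sqr; apply: le_trans t2; rewrite ler_wsqrtr.
have rr : r <= `|r| + r ^+ 2 by rewrite (le_trans (ler_norm r))// lerDl sqr_ge0.
split; rewrite /= ?in_itv/=.
  by rewrite -ler_norml (le_trans t1)// lerDr.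
split; rewrite /= ?in_itv/= -ler_norml (le_trans _ rr)//; apply: aux.
  by rewrite lerDl sqr_ge0.
by rewrite lerDr sqr_ge0.
Qed.

Lemma integrable_compact_support (f : spacetime R -> R) phi :
  continuous3 f -> test phi ->
  mu3.-integrable setT (EFin \o (fun z => f z * phi z)).
Proof.
move=> cf [sphi [r /supported_in_box[r' sup]]].
have cphi : continuous3 phi by have [] := sphi 0%N.
have cfp : continuous3 (fun z => f z * phi z).
  by move=> z; apply: cvgM; [exact: cf|exact: cphi].
have -> : (EFin \o (fun z => f z * phi z)) =
   (EFin \o (fun z => f z * phi z)) \_ (box r').
  apply/funext => z; rewrite patchE; case: ifPn => //.
  rewrite notin_setE => zb /=; have [->|/sup//] := eqVneq (phi z) 0.
  by rewrite mulr0.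
have mbox : measurable (box r' : set mR3).
  by apply: measurableX; [|apply: measurableX]; exact: measurable_itv.
apply/(integrable_mkcond _ mbox).
apply: measurable_bounded_integrable => //.
- rewrite /mu3 /= product_measure2E; last 2 first.
  + exact: measurable_itv.
  + by apply: measurableX; exact: measurable_itv.
  rewrite /mu2 /= product_measure1E; try exact: measurable_itv.
  have fin : (@lebesgue_measure R `[(- r')%R, r'%R]%classic < +oo)%E.
    by rewrite lebesgue_measure_itv/=; case: ifP => _; rewrite ltry.
  by rewrite !lte_mul_pinfty// ?ge0_fin_numE// ?lte_mul_pinfty// ?ge0_fin_numE.
- by apply: measurable_funTS; exact: continuous_measurable3.
- have cb : @compact R3 (box r').
    by apply: compact_setX; [|apply: compact_setX]; exact: segment_compact.
  have := @compact_bounded R R _ (continuous_compact (continuous_subspaceT cfp) cb).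
  by case=> M [Mr MH]; exists M; split => // x Mx y By; apply: (MH x Mx); exists y.
Qed.

Lemma integral3_lin (a : R) (f g : spacetime R -> R) phi :
  continuous3 f -> continuous3 g -> test phi ->
  integral3 (fun z => (a * f z + g z) * phi z) =
  a * integral3 (fun z => f z * phi z) + integral3 (fun z => g z * phi z).
Proof.
move=> cf cg tp; rewrite /integral3 -RintegralZl//; last first.
  exact: integrable_compact_support.
rewrite -RintegralD//; last 2 first.
- have -> : (EFin \o (fun z => a * (f z * phi z))) =
            (EFin \o (fun z => (a * f z) * phi z)).
    by apply/funext => z /=; rewrite mulrA.
  apply: integrable_compact_support => // z.
  by apply: cvgM; [exact: cvg_cst|exact: cf].
- exact: integrable_compact_support.
by congr Rintegral; apply/funext => z; rewrite mulrDl mulrA.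
Qed.

Lemma continuous_pairl (U V : topologicalType) (u : U) :
  continuous (fun v : V => (u, v)).
Proof.
move=> v; have cu : (fun=> u : U) x @[x --> v] --> u by exact: cvg_cst.
have ci : id x @[x --> v] --> v by exact: cvg_id.
exact: (cvg_pair cu ci).
Qed.

Lemma smooth_slice (F : spacetime R * spacetime R -> R) z :
  smooth33 F -> continuous3 (fun w => F (z, w)).
Proof.
move=> /(_ 0%N)[/= cF _] w.
apply: (@continuous_comp R3 (R3 * R3)%type R
  (fun w : R3 => (z : R3, w)) F); last exact: cF.
exact: continuous_pairl.
Qed.

Lemma Rcvg_unique (u : nat -> R) (a b : R) :
  u n @[n --> \oo] --> a -> u n @[n --> \oo] --> b -> a = b.
Proof. by apply: cvg_unique; exact: Rhausdorff. Qed.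

End Analysis.

(** * Symbols and the structure group *)

Section Algebra.
Context {R : realType}.
Local Notation T S := (@tspace R S).
Local Notation hom := Defs.hom.

Lemma hom_Inoise_lt0 (S : finType) kappa (a b : S) : 0 < kappa ->
  hom kappa (UI a, Some b) < 0 :> R.
Proof. by move=> k0; rewrite /hom /= /alpha_min; lra. Qed.

Lemma e_E (S : finType) (s s' : symb S) : (e_ s : T S) s' = (s' == s)%:R.
Proof. by rewrite ffunE. Qed.

Lemma tspace_decomp (S : finType) (t : T S) : t = \sum_s (t s : R) *: e_ s.
Proof.
apply/ffunP => s; rewrite sum_ffunE (bigD1 s)//= !ffunE eqxx.
rewrite big1 ?addr0 => [|i /negPf si]; first by rewrite /GRing.scale/= mulr1.
by rewrite !ffunE eq_sym si scaler0.
Qed.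

Lemma extend_linE (S S' : finType) (b : symb S -> T S') s :
  extend_lin b (e_ s) = b s.
Proof.
have lin : linear (fun t : T S => \sum_s ((t s : R) *: b s : T S')).
  move=> a t t'; rewrite scaler_sumr -big_split; apply: eq_bigr => i _ /=.
  by rewrite !ffunE scalerDl scalerA.
pose lf : {linear T S -> T S'} :=
  HB.pack (fun t : T S => \sum_s ((t s : R) *: b s : T S'))
    (GRing.isLinear.Build _ _ _ _ _ lin).
rewrite /extend_lin (_ : (fun _ => _) = lf)// lfunE/=.
rewrite (bigD1 s)//= e_E eqxx scale1r big1 ?addr0// => i /negPf si.
by rewrite e_E si scale0r.
Qed.

Lemma hom_ext (S S' : finType) (f g : 'Hom(T S, T S')) :
  (forall s, f (e_ s) = g (e_ s)) -> f = g.
Proof.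
move=> fg; apply/lfunP => t; rewrite [t]tspace_decomp !linear_sum.
by apply: eq_bigr => s _; rewrite !linearZ /= fg.
Qed.

Lemma Gamma_E (S : finType) (f : @character R S) s :
  Gamma_ f (e_ s) = e_ s + char_u f s.1 *: e_ (UOne, s.2).
Proof. exact: extend_linE. Qed.

Lemma char_uN (S : finType) (f : @character R S) u :
  char_u (fun g => - f g) u = - char_u f u.
Proof. by case: u => //=; rewrite oppr0. Qed.

Lemma Gamma_NK (S : finType) (f : @character R S) t :
  Gamma_ (fun g => - f g) (Gamma_ f t) = t.
Proof.
rewrite -comp_lfunE -[RHS](id_lfunE t); congr (fun_of_lfun _ t).
apply: hom_ext => s; rewrite id_lfunE comp_lfunE Gamma_E linearD linearZ/=.
by rewrite !Gamma_E/= char_uN scale0r addr0 -addrA -scalerDl addNr scale0r addr0.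
Qed.

Lemma Gamma_inv (S : finType) (f : @character R S) t :
  (Gamma_ f)^-1%VF t = Gamma_ (fun g => - f g) t.
Proof.
have opK : f = (fun g => - (- f g)) by apply/funext => g; rewrite opprK.
have ker0 : lker (Gamma_ f) == 0%VS.
  by apply/lker0P; apply: can_inj (Gamma_NK f).
by rewrite -{1}[t](Gamma_NK (fun g => - f g)) -opK lker0_lfunK.
Qed.

(** Gam z z' maps u to u + chr_diff u 1, and acts likewise on u s ([GamE]), so
    that bounds and periodicity of Gam are statements about this number. *)
Definition chr_diff (S : finType) (Z : @model R S) z z' (u : usymb S) : R :=
  char_u (chr Z z') u - char_u (chr Z z) u.

Lemma GamE (S : finType) (Z : @model R S) z z' s :
  Gam Z z z' (e_ s) = e_ s + chr_diff Z z z' s.1 *: e_ (UOne, s.2).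
Proof.
rewrite /Gam comp_lfunE Gamma_inv Gamma_E linearD linearZ/= !Gamma_E/=.
rewrite char_uN scale0r addr0 -addrA -scalerDl; congr (_ + _ *: _).
exact: addrC.
Qed.

(** * Noise substitutions *)

Section NoiseMap.
Variables (S S' : finType) (nu : S -> seq S') (c : S -> S -> R).

Definition subst_u (u : usymb S) : seq (usymb S') :=
  match u with
  | UOne => [:: UOne] | UX i => [:: UX i] | UI s => [seq UI s' | s' <- nu s]
  end.

Definition subst_o (o : option S) : seq (option S') :=
  if o is Some s then [seq Some s' | s' <- nu s] else [:: None].

Definition counter (s : symb S) : R :=
  if s is (UI a, Some b) then c a b else 0.

(** The double sum is the multiplicative extension of s |-> sum (nu s) that
    commutes with I; the last term shifts products of noises by constants, as
    renormalization does. *)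
Definition noise_map : 'Hom(T S, T S') :=
  extend_lin (fun s => \sum_(u <- subst_u s.1) \sum_(o <- subst_o s.2) e_ (u, o)
    + counter s *: e_ (UOne, None)).

(** The dual action f |-> f nu^+ on characters.  As every Gamma fixes 1, it makes
    noise_map intertwine the structure groups whatever the counterterm is. *)
Definition subst_char (f : @character R S') : character S :=
  fun g => match g with
  | GX i => f (GX i) | GJ s => \sum_(s' <- nu s) f (GJ s') end.

Definition subst_model (Z : @model R S') : @model R S :=
  Model (fun z t => Pi Z z (noise_map t)) (fun z => subst_char (chr Z z)).

Lemma noise_mapE u o : noise_map (e_ (u, o)) =
  \sum_(u' <- subst_u u) \sum_(o' <- subst_o o) e_ (u', o')
  + counter (u, o) *: e_ (UOne, None).
Proof. exact: extend_linE. Qed.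

Lemma noise_map_One : noise_map (e_ (UOne, None)) = e_ (UOne, None).
Proof. by rewrite noise_mapE /= !big_seq1 scale0r addr0. Qed.

Lemma noise_map_X i : noise_map (e_ (UX i, None)) = e_ (UX i, None).
Proof. by rewrite noise_mapE /= !big_seq1 scale0r addr0. Qed.

Lemma noise_map_noise s :
  noise_map (e_ (UOne, Some s)) = \sum_(s' <- nu s) e_ (UOne, Some s').
Proof. by rewrite noise_mapE /= big_seq1 big_map scale0r addr0. Qed.

Lemma noise_map_Xnoise i s :
  noise_map (e_ (UX i, Some s)) = \sum_(s' <- nu s) e_ (UX i, Some s').
Proof. by rewrite noise_mapE /= big_seq1 big_map scale0r addr0. Qed.

Lemma noise_map_I s :
  noise_map (e_ (UI s, None)) = \sum_(s' <- nu s) e_ (UI s', None).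
Proof.
rewrite noise_mapE /= big_map scale0r addr0.
by apply: eq_bigr => s' _; rewrite big_seq1.
Qed.

Lemma homu_subst (kappa : R) u u' :
  u' \in subst_u u -> homu kappa u' = homu kappa u.
Proof.
case: u => [|i|s] /=; last by case/mapP => s' _ ->.
- by rewrite inE => /eqP->.
- by rewrite inE => /eqP->.
Qed.

(** The terms with nu have the homogeneity of s.  The counterterm has
    homogeneity 0 and occurs only for s = I(a) b, where hom s < 0. *)
Lemma hom_noise_map (kappa : R) s s' : 0 < kappa ->
  noise_map (e_ s) s' != 0 :> R -> hom kappa s <= hom kappa s'.
Proof.
move=> k0; apply: contraR; rewrite -ltNge; case: s => u o lt_s; apply/eqP.
rewrite noise_mapE ffunE sum_ffunE big1_seq ?add0r => [|u' /= u'u].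
  case: u o lt_s => [|i|a] [b|] /=; try by rewrite scale0r ffunE.
  move=> lt_s; rewrite !ffunE; case: eqP => [s1|_]; last exact: scaler0.
  have s'_lt0 := lt_trans lt_s (hom_Inoise_lt0 a b k0).
  by move: s'_lt0; rewrite s1 /hom/= addr0 ltxx.
rewrite sum_ffunE big1_seq// => o' /= o'o; rewrite e_E; case: eqP => // s'E.
move: lt_s; rewrite s'E /hom/= (homu_subst _ u'u).
case: o o'o => [b|] /=; first by case/mapP => b' _ ->; rewrite ltxx.
by rewrite inE => /eqP->; rewrite ltxx.
Qed.

Lemma char_u_subst f u :
  char_u (subst_char f) u = \sum_(u' <- subst_u u) char_u f u'.
Proof. by case: u => [|i|s] /=; rewrite ?big_seq1 ?big_map. Qed.

(** On u s the identity amounts to [char_u_subst], as every Gamma fixes both the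
    noises and the counterterm. *)
Lemma noise_map_Gamma f t :
  noise_map (Gamma_ (subst_char f) t) = Gamma_ f (noise_map t).
Proof.
rewrite -!comp_lfunE; congr (fun_of_lfun _ t); apply: hom_ext => -[u o].
rewrite !comp_lfunE Gamma_E linearD linearZ /= !noise_mapE.
rewrite [RHS]linearD /= [Gamma_ f (_ *: _)]linearZ /= Gamma_E/= !scale0r !addr0.
rewrite big_seq1 addrAC.
congr (_ + _); rewrite char_u_subst scaler_suml -big_split linear_sum/=.
apply: eq_bigr => u' _; rewrite scaler_sumr -big_split linear_sum/=.
by apply: eq_bigr => o' _; rewrite Gamma_E.
Qed.

Lemma noise_map_Gam (Z : @model R S') z z' t :
  noise_map (Gam (subst_model Z) z z' t) = Gam Z z z' (noise_map t).
Proof.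
rewrite /Gam !comp_lfunE !Gamma_inv -!noise_map_Gamma.
congr (noise_map (fun_of_lfun (Gamma_ _) _)); apply/funext => -[i|s] //=.
by rewrite sumrN.
Qed.

Lemma chr_diff_subst (Z : @model R S') z z' u :
  chr_diff (subst_model Z) z z' u = \sum_(u' <- subst_u u) chr_diff Z z z' u'.
Proof. by rewrite /chr_diff !char_u_subst sumrB. Qed.

End NoiseMap.

Section Composition.
Variables (S S' S'' : finType) (nu : S' -> seq S'') (c : S' -> S' -> R).
Variables (mu : S -> seq S') (d : S -> S -> R).

Let nu_mu (s : S) : seq S'' := flatten [seq nu a | a <- mu s].

Lemma subst_u_comp u :
  subst_u nu_mu u = flatten [seq subst_u nu u' | u' <- subst_u mu u].
Proof. by case: u => //= s; rewrite map_flatten -!map_comp. Qed.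

Lemma subst_o_comp o :
  subst_o nu_mu o = flatten [seq subst_o nu o' | o' <- subst_o mu o].
Proof. by case: o => //= s; rewrite map_flatten -!map_comp. Qed.

(** The inner counterterm is fixed by the outer map, and the outer one is picked
    up once for each pair of noises in the image of I(a) b. *)
Lemma noise_map_comp t : noise_map nu c (noise_map mu d t) =
  noise_map nu_mu (fun a b =>
    d a b + \sum_(a' <- mu a) \sum_(b' <- mu b) c a' b') t.
Proof.
rewrite -comp_lfunE; congr (fun_of_lfun _ t); apply: hom_ext => -[u o].
rewrite comp_lfunE noise_mapE linearD linearZ/= noise_map_One linear_sum.
under eq_bigr do (rewrite linear_sum/=; under eq_bigr do rewrite noise_mapE;
  rewrite big_split/=).
rewrite noise_mapE big_split/= -addrA; congr (_ + _).
  rewrite subst_u_comp subst_o_comp big_flatten big_map /=.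
  apply: eq_bigr => u' _; rewrite exchange_big; apply: eq_bigr => u'' _.
  by rewrite big_flatten big_map.
under eq_bigr do rewrite -scaler_suml.
rewrite -scaler_suml -scalerDl; congr (_ *: _); rewrite addrC.
case: u => [|i|a] /=; last case: o => [b|] /=; rewrite ?big_seq1 ?add0r ?addr0.
- by rewrite big1.
- by rewrite big1.
- by rewrite big_map; congr (_ + _); apply: eq_bigr => a' _; rewrite big_map.
- by rewrite big_map big1// => a' _; rewrite big_seq1.
Qed.

End Composition.

Lemma noise_map_single (S : finType) (c : S -> S -> R) s :
  noise_map (fun s => [:: s]) c (e_ s) = e_ s + counter c s *: e_ (UOne, None).
Proof. by case: s => [[|i|a] [b|]]; rewrite noise_mapE /= !big_seq1. Qed.

End Algebra.

(** * Pulling back models along a noise substitution *)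

Section Models.
Context {R : realType}.
Local Notation T S := (@tspace R S).
Local Notation hom := Defs.hom.
Implicit Types (z w : spacetime R) (phi : spacetime R -> R).

(** Phrased for Pi_z, and also for the differences Pi_z - Pi'_z that measure the
    distance of two models. *)
Definition linear_family (S : finType)
    (L : T S -> (spacetime R -> R) -> R) : Prop :=
  forall a t t' phi, L (a *: t + t') phi = a * L t phi + L t' phi.

Section LinearFamily.
Variables (S : finType) (L : T S -> (spacetime R -> R) -> R).
Hypothesis linL : linear_family L.

Lemma family0 phi : L 0 phi = 0.
Proof. by have := linL (-1) 0 0 phi; rewrite scaler0 addr0 mulN1r addNr. Qed.

Lemma family_sum (I : Type) (r : seq I) (a : I -> R) (t : I -> T S) phi :
  L (\sum_(i <- r) a i *: t i) phi = \sum_(i <- r) a i * L (t i) phi.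
Proof.
elim: r => [|i r IH]; first by rewrite !big_nil family0.
by rewrite !big_cons linL IH.
Qed.

Lemma family_sum1 (I : Type) (r : seq I) (t : I -> T S) phi :
  L (\sum_(i <- r) t i) phi = \sum_(i <- r) L (t i) phi.
Proof.
under eq_bigr do rewrite -[t _]scale1r.
by rewrite family_sum; apply: eq_bigr => i _; rewrite mul1r.
Qed.

Lemma family_decomp t phi : L t phi = \sum_s (t s : R) * L (e_ s) phi.
Proof. by rewrite {1}[t]tspace_decomp family_sum. Qed.

(** A sum of symbols of homogeneity at least a obeys the bound lambda^a, because
    lambda <= 1. *)
Lemma scaling_bound_lin kappa z a c (t : T S) : 0 <= c ->
  (forall s, (t s : R) != 0 -> a <= hom kappa s) ->
  (forall s, scaling_bound (L (e_ s)) z (hom kappa s) c) ->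
  scaling_bound (L t) z a (c * \sum_s `|t s : R|).
Proof.
move=> c0 ta sL phi lam Bphi l01.
have /boolp.choice[v vP] s : exists v,
    pairs_C2 (L (e_ s)) (rescale z lam phi) v /\ `|v| <= c * lam `^ hom kappa s.
  by have [v v1 v2] := sL s phi lam Bphi l01; exists v.
exists (\sum_s (t s : R) * v s).
  move=> psi_ tpsi cpsi.
  under eq_fun do rewrite family_decomp.
  apply: cvg_big => [|s _]; first exact: add_continuous.
  by apply: cvgM; [exact: cvg_cst|exact: (vP s).1].
rewrite mulrAC mulr_sumr; apply: le_trans (ler_norm_sum _ _ _) _.
apply: ler_sum => s _; rewrite normrM mulrC.
have [->|ts] := eqVneq (t s : R) 0; first by rewrite normr0 !mulr0.
apply: ler_wpM2r => //; apply: le_trans (vP s).2 _; apply: ler_wpM2l => //.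
exact: ger_powR (ta s ts).
Qed.

End LinearFamily.

Lemma scaling_bound_le (L : (spacetime R -> R) -> R) z a c c' : c <= c' ->
  scaling_bound L z a c -> scaling_bound L z a c'.
Proof.
move=> cc' sL phi lam Bphi l01; have [v v1 v2] := sL phi lam Bphi l01.
by exists v => //; apply: le_trans v2 _; rewrite ler_wpM2r// powR_ge0.
Qed.

(** Distributions vanish outside the test functions, which makes their
    restriction to test functions determine them. *)
Lemma dist_eq (d d' : Defs.distribution R) :
  (forall phi, test phi -> d phi = d' phi) -> d = d'.
Proof.
move=> dd'; have : (d : _ -> R) = d'.
  apply/funext => phi; have [/dd'//|tp] := pselect (test phi).
  by case: d d' {dd'} => [p ? p0 ?] [p' ? p'0 ?] /=; rewrite p0// p'0.
case: d d' {dd'} => [p p1 p2 p3] [p' p1' p2' p3'] /= pp'; subst p'.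
by congr Distribution; exact: Prop_irrelevance.
Qed.

Lemma chr_diff_coef (S : finType) (Z : @model R S) z z' u :
  chr_diff Z z z' u =
  (Gam Z z z' (e_ (u, None)) (UOne, None) : R)
    - (e_ (u, None) : T S) (UOne, None).
Proof.
by rewrite GamE /= !ffunE eqxx addrC addKr; exact/esym/mulr1.
Qed.

(** Below the homogeneity of s, the only component of Gam s is the one that
    [GamE] puts on 1 or on the noise of s. *)
Lemma comp_norm_Gam (S : finType) (Z : @model R S) kappa m s z z' :
  m < hom kappa s ->
  comp_norm kappa m (Gam Z z z' (e_ s)) =
  if hom kappa (UOne, s.2) == m then `|chr_diff Z z z' s.1| else 0.
Proof.
move=> ms; rewrite /comp_norm GamE big_mkcond (bigD1 (UOne, s.2))//=.
rewrite [X in _ + X]big1 ?addr0.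
  case: eqP => // sm; rewrite !ffunE eqxx; case: eqP => [s1|_].
    by move: ms; rewrite -sm s1 ltxx.
  by rewrite add0r; congr `|_|; exact: mulr1.
move=> s' /negPf s's; case: eqP => // s'm; rewrite !ffunE s's.
case: eqP => [ss|_]; first by move: ms; rewrite -s'm ss ltxx.
by rewrite scaler0 addr0 normr0.
Qed.

Section Substitution.
Variables (S S' : finType) (nu : S -> seq S') (c : S -> S -> R).
Variables (kappa : R) (kappa_gt0 : 0 < kappa) (K chi : spacetime R -> R).
Local Notation A := (noise_map nu c).
Local Notation pull := (subst_model nu c).

Lemma noise_map_norm : exists2 N : R, 0 < N &
  forall s, \sum_s' `|A (e_ s) s' : R| <= N.
Proof.
exists (1 + \sum_s \sum_s' `|A (e_ s) s' : R|).
  by rewrite ltr_pwDl// sumr_ge0// => s _; rewrite sumr_ge0.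
move=> s; rewrite (bigD1 s)//= addrCA lerDl addr_ge0// sumr_ge0// => s' _.
by rewrite sumr_ge0.
Qed.

Lemma subst_is_model (Z : @model R S') :
  is_model kappa Z -> is_model kappa (pull Z).
Proof.
case=> lin PG Pb Gb; have [N N0 AN] := noise_map_norm; split.
- by move=> z a t t' phi /=; rewrite linearP lin.
- by move=> z z' t; rewrite /= noise_map_Gam PG.
- move=> D /Pb[k kP]; exists (`|k| * N) => z s Dz.
  apply: (@scaling_bound_le _ _ _ (`|k| * \sum_s' `|A (e_ s) s' : R|)).
    by rewrite ler_wpM2l.
  apply: (@scaling_bound_lin _ _ (lin z) kappa) => // s' => [As'|].
    exact: hom_noise_map As'.
  exact: scaling_bound_le (ler_norm k) (kP _ _ Dz).
move=> D /Gb[k kP]; exists (`|k| * \sum_u (size (subst_u nu u))%:R).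
move=> z z' s s' Dz Dz' ss'; rewrite comp_norm_Gam//.
set p := parabolic _ `^ _; have p0 : 0 <= p by exact: powR_ge0.
have b0 : 0 <= \sum_u (size (subst_u nu u))%:R :> R by exact: sumr_ge0.
case: eqP => [s1s'|_]; last by rewrite !mulr_ge0.
rewrite chr_diff_subst.
(* Gam has the same increment at u' as at the products of u' with a noise, so
   it may be bounded on u' alone, where it is the component of homogeneity 0. *)
have d_le u' : u' \in subst_u nu s.1 -> `|chr_diff Z z z' u'| <= `|k| * p.
  move=> /(homu_subst kappa) hu'.
  have lt_u : hom kappa (@UOne S', None) < hom kappa (u', None).
    by move: ss'; rewrite -s1s' /hom /= hu' add0r addr0 addr0 ltrDr.
  have := kP z z' (u', None) (UOne, None) Dz Dz' lt_u.
  rewrite comp_norm_Gam//= eqxx => /le_trans; apply.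
  have -> : hom kappa (u', None) - hom kappa (@UOne S', None) =
            hom kappa s - hom kappa s'.
    by rewrite -s1s' /hom /= hu' !addr0 subr0 add0r addrK.
  by apply: ler_wpM2r => //; exact: ler_norm.
apply: le_trans (ler_norm_sum _ _ _) _.
apply: (@le_trans _ _ (\sum_(u' <- subst_u nu s.1) `|k| * p)).
  by rewrite big_seq [leRHS]big_seq; apply: ler_sum.
rewrite big_const_seq count_predT iter_addr_0 -mulr_natr mulrAC.
apply: ler_wpM2r => //; apply: ler_wpM2l => //.
by rewrite (bigD1 s.1)//= lerDl sumr_ge0.
Qed.

Lemma subst_is_periodic (Z : @model R S') : is_periodic Z -> is_periodic (pull Z).
Proof.
case=> Pp Gp; split; first by move=> z t i phi tphi; exact: Pp.
move=> z z' i; apply: hom_ext => s; rewrite !GamE !chr_diff_subst.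
by congr (_ + _ *: _); apply: eq_bigr => u _; rewrite !chr_diff_coef Gp.
Qed.

Lemma subst_is_admissible (Z : @model R S') :
  is_admissible kappa K chi Z -> is_admissible kappa K chi (pull Z).
Proof.
case=> aM aP a1 aX aXS aI acX acJ; have lin z := Pi_linear aM z.
split.
- exact: subst_is_model.
- exact: subst_is_periodic.
- by move=> z phi tphi; rewrite /= noise_map_One a1.
- by move=> z i phi tphi; rewrite /= noise_map_X aX.
- move=> z i s phi tphi; rewrite /= noise_map_Xnoise noise_map_noise.
  by rewrite !(family_sum1 (lin z)); apply: eq_bigr => s' _; exact: aXS.
- move=> z s phi tphi; rewrite /= noise_map_I noise_map_noise.
  rewrite !(family_sum1 (lin z)) mulr_suml -big_split; apply: eq_bigr => s' _.
  exact: aI.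
- by move=> z i /=; exact: acX.
- move=> z s; rewrite /pairs_K /= noise_map_noise -sumrN.
  under eq_fun do rewrite (family_sum1 (lin z)).
  by apply: cvg_big => [|s' _]; [exact: add_continuous|exact: acJ].
Qed.

(** The representing functions of a linear combination of symbols combine
    linearly, by linearity of the integral against a test function. *)
Lemma smooth_model_lin (Z : @model R S') :
  is_model kappa Z -> is_smooth_model Z ->
  forall t, exists2 F, smooth33 F & forall z phi, test phi ->
    Pi Z z t phi = integral3 (fun w => F (z, w) * phi w).
Proof.
move=> mZ sZ; pose P t := exists2 F, smooth33 F & forall z phi, test phi ->
    Pi Z z t phi = integral3 (fun w => F (z, w) * phi w).
have Plin a t t' : P t -> P t' -> P (a *: t + t').
  move=> [F sF iF] [F' sF' iF']; exists (fun x => a * F x + F' x).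
    by move=> k; apply: Ck_lin; [exact: sF|exact: sF'].
  move=> z phi tphi; rewrite (Pi_linear mZ) iF// iF'// integral3_lin//;
    exact: smooth_slice.
have P0 : P 0.
  have e1 := sZ (UOne, None).
  by rewrite -(addNr (e_ (UOne, None))) -scaleN1r; exact: Plin.
move=> t; rewrite -/(P t) [t]tspace_decomp; apply: big_ind => //.
- by move=> u v Pu Pv; rewrite -[u]scale1r; exact: Plin.
- by move=> s _; rewrite -[_ *: _]addr0; apply: Plin => //; exact: sZ.
Qed.

Lemma subst_is_smooth (Z : @model R S') :
  is_model kappa Z -> is_smooth_model Z -> is_smooth_model (pull Z).
Proof. by move=> mZ sZ s; exact: smooth_model_lin. Qed.

(** Smooth approximations of Z pull back to smooth approximations of the
    pullback; as the substitution has norm at most N, approximating Z up to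
    eps / N suffices. *)
Theorem subst_model_space (Z : @model R S') :
  model_space kappa K chi Z -> model_space kappa K chi (pull Z).
Proof.
move=> [aZ approx]; split; first exact: subst_is_admissible.
move=> a b eps eps0; have [N N0 AN] := noise_map_norm.
have [Z' [aZ' sZ' dZ']] := approx a b (eps / N) (divr_gt0 eps0 N0).
exists (pull Z'); split; first exact: subst_is_admissible.
  by apply: subst_is_smooth => //; exact: adm_model aZ'.
move=> z s zab.
pose L t phi := Pi Z z t phi - Pi Z' z t phi.
have linL : linear_family L.
  move=> k t t' phi; rewrite /L.
  rewrite (Pi_linear (adm_model aZ)) (Pi_linear (adm_model aZ')).
  by rewrite mulrBr opprD addrACA.
apply: (@scaling_bound_le _ _ _ (eps / N * \sum_s' `|A (e_ s) s' : R|)).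
  by rewrite mulrAC ler_pdivrMr// ler_wpM2l// ltW.
apply: (scaling_bound_lin linL (kappa := kappa)) => [|s' As'|s'].
- by rewrite divr_ge0// ltW.
- exact: hom_noise_map As'.
- exact: dZ'.
Qed.

End Substitution.

(** * Admissible models are determined by their noises and products *)

Section Uniqueness.
Variables (S : finType) (kappa : R) (K chi : spacetime R -> R).
Variables (Z Z' : @model R S).
Hypothesis aZ : is_admissible kappa K chi Z.
Hypothesis aZ' : is_admissible kappa K chi Z'.

(** The character at J(s) is a limit of values of the noise s on truncations of
    the kernel. *)
Lemma admissible_chr_eq z :
  (forall s, Pi Z z (e_ (UOne, Some s)) = Pi Z' z (e_ (UOne, Some s))) ->
  chr Z z = chr Z' z.
Proof.
move=> noise; apply/funext => -[i|s].
  by rewrite (adm_chrX aZ) (adm_chrX aZ').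
have := @adm_chrJ _ _ _ _ _ _ aZ' z s; have := @adm_chrJ _ _ _ _ _ _ aZ z s.
rewrite /pairs_K noise.
by move=> lim lim'; apply: oppr_inj; exact: Rcvg_unique lim lim'.
Qed.

Lemma admissible_U_eq z u :
  (forall s, Pi Z z (e_ (UOne, Some s)) = Pi Z' z (e_ (UOne, Some s))) ->
  Pi Z z (e_ (u, None)) = Pi Z' z (e_ (u, None)).
Proof.
move=> noise; apply: dist_eq => phi tphi; case: u => [|i|s].
- by rewrite (adm_One aZ)// (adm_One aZ').
- by rewrite (adm_X aZ)// (adm_X aZ').
- by rewrite (adm_I aZ)// (adm_I aZ')// noise admissible_chr_eq.
Qed.

(** The symbols 1 and X_i are explicit, X_i s is a function times the noise s, and
    I(s) is the convolution of s with K up to a constant given by the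
    character. *)
Lemma admissible_eq :
  (forall z s, Pi Z z (e_ (UOne, Some s)) = Pi Z' z (e_ (UOne, Some s))) ->
  (forall z a b, Pi Z z (e_ (UI a, Some b)) = Pi Z' z (e_ (UI a, Some b))) ->
  Z = Z'.
Proof.
move=> noise prod.
have chrE : chr Z = chr Z' by apply/funext => z; exact: admissible_chr_eq.
have PiE : Pi Z = Pi Z'.
  apply/funext => z; apply/funext => t; apply: dist_eq => phi tphi.
  rewrite (family_decomp (Pi_linear (adm_model aZ) z)).
  rewrite (family_decomp (Pi_linear (adm_model aZ') z)).
  apply: eq_bigr => -[u [s|]] _; congr (_ * _); last by rewrite admissible_U_eq.
  case: u => [|i|a]; rewrite ?noise ?prod//.
  by rewrite (adm_XS aZ)// (adm_XS aZ')// noise.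
by move: PiE chrE; case: (Z) => ? ?; case: (Z') => ? ? /= -> ->.
Qed.

End Uniqueness.

End Models.

(** * Translation and renormalization as noise substitutions *)

Section Instances.
Context {R : realType}.
Local Notation T S := (@tspace R S).
Local Notation hom := Defs.hom.
Implicit Types (z w : spacetime R) (phi : spacetime R -> R) (C : R).

Definition both_noises (s : noise1) : seq noise2 := [:: Xi2; H2].
Definition only_Xi (s : noise1) : seq noise2 := [:: Xi2].

Definition cterm C (a b : noise1) : R := - C.
Definition cterm_H C (a b : noise2) : R :=
  if a is Xi2 then if b is Xi2 then - C else 0 else 0.

Definition ren C : @model R noise1 -> model noise1 :=
  subst_model (fun s => [:: s]) (cterm C).

(** The map M' of T_g^H, which renormalizes only the symbol I(Xi) Xi that comes
    from T_g: products with H need no counterterm. *)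
Definition ren_H C : @model R noise2 -> model noise2 :=
  subst_model (fun s => [:: s]) (cterm_H C).

Definition translated : @model R noise2 -> model noise1 :=
  subst_model both_noises (fun _ _ => 0).

Lemma tauHE : @tauH R = noise_map both_noises (fun _ _ => 0).
Proof.
apply: hom_ext => -[u o]; rewrite !extend_linE.
rewrite (_ : counter _ _ = 0) ?scale0r ?addr0; last by case: u o => [|i|a] [].
by case: u o => [|i|a] [].
Qed.

Lemma inclE : @Defs.incl R = noise_map only_Xi (fun _ _ => 0).
Proof.
apply: hom_ext => -[u o]; rewrite !extend_linE.
rewrite (_ : counter _ _ = 0) ?scale0r ?addr0; last by case: u o => [|i|a] [].
by case: u o => [|i|a] [[]|]; rewrite /= !big_seq1.
Qed.

Lemma MrenE C : Mren C = noise_map (fun s => [:: s]) (cterm C).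
Proof.
apply: hom_ext => s; rewrite extend_linE noise_map_single.
by case: s => [[|i|[]] [[]|]] /=; rewrite ?scale0r ?addr0 ?eqxx ?scaleNr.
Qed.

Lemma subst_char_single (S : finType) (f : @character R S) :
  subst_char (fun s => [:: s]) f = f.
Proof. by apply/funext => -[i|s] //=; rewrite big_seq1. Qed.

Lemma char_tauHE (f : @character R noise2) :
  char_tauH f = subst_char both_noises f.
Proof. by apply/funext => -[i|s] //=; rewrite !big_cons big_nil addr0. Qed.

Lemma translationE kappa K chi h (Z : @model R noise1) :
  translation kappa K chi h Z = omap translated (extension kappa K chi h Z).
Proof.
rewrite /translation; case: extension => //= ZE; congr (Some (Model _ _)).
  by rewrite tauHE.
by apply/funext => z; exact: char_tauHE.
Qed.

Lemma single_comp (S S' : finType) (nu : S -> seq S') c d t :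
  noise_map (R := R) nu c (noise_map (fun s => [:: s]) d t) =
  noise_map nu (fun a b => d a b + c a b) t.
Proof.
rewrite noise_map_comp; congr (fun_of_lfun (noise_map _ _) t).
  by apply/funext => s /=; rewrite cats0.
by apply/funext => a; apply/funext => b; rewrite !big_seq1.
Qed.

Lemma comp_single (S S' : finType) (mu : S -> seq S') c d t :
  noise_map (R := R) (fun s => [:: s]) c (noise_map mu d t) =
  noise_map mu (fun a b => d a b + \sum_(a' <- mu a) \sum_(b' <- mu b) c a' b') t.
Proof.
rewrite noise_map_comp; congr (fun_of_lfun (noise_map _ _) t).
by apply/funext => s; exact: flatten_seq1.
Qed.

(** Of the four products in (I(Xi) + I(H)) (Xi + H) exactly one, I(Xi) Xi,
    receives the counterterm. *)
Lemma ren_H_tauH C t : noise_map (fun s => [:: s]) (cterm_H C) (tauH t) =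
  tauH (noise_map (fun s => [:: s]) (cterm C) t).
Proof.
rewrite tauHE comp_single single_comp; congr (fun_of_lfun (noise_map _ _) t).
apply/funext => a; apply/funext => b.
by rewrite /both_noises !big_cons !big_nil /= !addr0 add0r.
Qed.

Lemma ren_H_incl C t : noise_map (fun s => [:: s]) (cterm_H C) (Defs.incl t) =
  Defs.incl (noise_map (fun s => [:: s]) (cterm C) t).
Proof.
rewrite inclE comp_single single_comp; congr (fun_of_lfun (noise_map _ _) t).
apply/funext => a; apply/funext => b.
by rewrite /only_Xi !big_seq1 add0r addr0.
Qed.

Lemma ren_translated C ZE : ren C (translated ZE) = translated (ren_H C ZE).
Proof.
rewrite /ren /translated /subst_model /=; congr Model.
  apply/funext => z; apply/funext => t.
  by rewrite -tauHE -ren_H_tauH.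
by apply/funext => z; rewrite !subst_char_single.
Qed.

Lemma renK C Z : ren (- C) (ren C Z) = Z.
Proof.
rewrite /ren /subst_model /=; case: Z => P f /=; congr Model.
  apply/funext => z; apply/funext => t; rewrite single_comp; congr (P z _).
  rewrite -[RHS](id_lfunE t); congr (fun_of_lfun _ t); apply: hom_ext => s.
  rewrite noise_map_single id_lfunE -[RHS]addr0; congr (_ + _).
  case: s => [[|i|a] [b|]]; rewrite /= ?scale0r//.
  by rewrite /cterm addNr scale0r.
by apply/funext => z; rewrite !subst_char_single.
Qed.

(** * Existence and uniqueness of renormalized and extended models *)

Section Existence.
Variables (kappa : R) (kappa_gt0 : 0 < kappa) (K chi : spacetime R -> R).

Lemma is_renormalization_ren C Z : model_space kappa K chi Z ->
  is_renormalization kappa K chi C Z (ren C Z).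
Proof.
move=> sZ; split; first exact: subst_model_space.
  by move=> z s _; rewrite MrenE.
by move=> z z' s _; rewrite !GamE /chr_diff /= !subst_char_single.
Qed.

Lemma is_renormalization_unique C Z Z1 Z2 :
  is_renormalization kappa K chi C Z Z1 ->
  is_renormalization kappa K chi C Z Z2 ->
  Z1 = Z2.
Proof.
move=> [[a1 _] p1 _] [[a2 _] p2 _].
by apply: (admissible_eq a1 a2) => [z s|z a b]; rewrite p1// p2.
Qed.

Lemma renormalizationE C Z : model_space kappa K chi Z ->
  renormalization kappa K chi C Z = Some (ren C Z).
Proof.
move=> sZ; apply: the_eq_Some; first exact: is_renormalization_ren.
by move=> Z1 Z2; exact: is_renormalization_unique.
Qed.

Lemma is_product_unique a b u g (p p' : Defs.distribution R) :
  is_product a b u g p -> is_product a b u g p' -> p = p'.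
Proof.
move=> [[u_ [g_ [cu cg]]] lim] [_ lim']; apply: dist_eq => phi tphi.
exact: Rcvg_unique (lim _ _ cu cg _ tphi) (lim' _ _ cu cg _ tphi).
Qed.

(** H is the function h, the noise Xi and I(Xi) Xi come from Z, and the three
    remaining products are limits of products of smooth approximations.  Their
    factors I(a) are already known from the noises. *)
Lemma is_extension_unique h Z Z1 Z2 :
  is_extension kappa K chi h Z Z1 -> is_extension kappa K chi h Z Z2 -> Z1 = Z2.
Proof.
move=> [[a1 _] P1 _ _ H1 E1] [[a2 _] P2 _ _ H2 E2].
have incl_e s : Defs.incl (e_ s : T noise1) = e_ (incl_symb s).
  exact: extend_linE.
have noise z s : Pi Z1 z (e_ (UOne, Some s)) = Pi Z2 z (e_ (UOne, Some s)).
  case: s; last by apply: dist_eq => phi tphi; rewrite H1// H2.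
  by rewrite -[(UOne, Some Xi2)]/(incl_symb (UOne, Some Xi)) -incl_e P1 P2.
have U z u : Pi Z1 z (e_ (u, None)) = Pi Z2 z (e_ (u, None)).
  by apply: (admissible_U_eq a1 a2); exact: noise.
apply: (admissible_eq a1 a2) => // z a b.
have [/codomP[s abs]|nab] := boolP ((UI a, Some b) \in codom incl_symb).
  by rewrite abs -incl_e P1 P2.
have neg := hom_Inoise_lt0 a b kappa_gt0.
move: (E1 z _ _ neg nab) (E2 z _ _ neg nab); rewrite /extension_product.
by case: b {nab neg} => /=; rewrite U noise; exact: is_product_unique.
Qed.

(** The conditions on an extension mention I(Xi) Xi only through the inclusion
    of T_g, with which the two renormalizations commute. *)
Lemma ren_H_extension C h Z ZE :
  is_extension kappa K chi h Z ZE ->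
  is_extension kappa K chi h (ren C Z) (ren_H C ZE).
Proof.
case=> sp eP eX eJ eH eprod.
have fixed z s : s != (UI Xi2, Some Xi2) ->
    Pi (ren_H C ZE) z (e_ s) = Pi ZE z (e_ s).
  move=> ns; rewrite /= noise_map_single (_ : counter _ _ = 0) ?scale0r ?addr0//.
  by move: ns; case: s => [[|i|[]] [[]|]].
split.
- exact: subst_model_space.
- by move=> z t; rewrite /= ren_H_incl eP.
- by move=> z i /=.
- by move=> z /=; rewrite !big_seq1.
- by move=> z phi tphi; rewrite fixed ?eH.
move=> z u s neg ncod; have nren : (u, Some s) != (UI Xi2, Some Xi2).
  by apply: contra ncod => /eqP->; apply/codomP; exists (UI Xi, Some Xi).
have nU : (u, None) != (UI Xi2, Some Xi2) by apply/eqP.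
by rewrite /extension_product !fixed//; exact: eprod.
Qed.

End Existence.
End Instances.

(** * Translation and renormalization commute *)

Theorem corollary3p19 (R : realType) (kappa : R) (K chi : spacetime R -> R)
    (kappa_small : 0 < kappa < 3^-1) (K_kernel : is_kernel K)
    (chi_cutoff : is_cutoff chi)
    (h : plane R -> R) (h_L2 : L2_torus h) (C : R)
    (Z : model noise1) (Z_model : model_space kappa K chi Z) :
  obind (renormalization kappa K chi C) (translation kappa K chi h Z)
    = obind (translation kappa K chi h) (renormalization kappa K chi C Z)
  /\ (translation kappa K chi h Z <> None ->
      obind (renormalization kappa K chi C) (translation kappa K chi h Z) <> None).
Proof.
have kappa_gt0 : 0 < kappa by case/andP: kappa_small.
rewrite renormalizationE//= !translationE.
have [[ZE extZ]|noext] := pselect (exists ZE, is_extension kappa K chi h Z ZE).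
  have extE Z' ZE' : is_extension kappa K chi h Z' ZE' ->
      extension kappa K chi h Z' = Some ZE'.
    by move=> ext; apply: the_eq_Some => //; exact: is_extension_unique.
  rewrite (extE _ _ extZ) (extE _ _ (ren_H_extension kappa_gt0 C extZ)) /=.
  rewrite renormalizationE//; last exact: subst_model_space (ext_space extZ).
  by rewrite ren_translated.
have -> : extension kappa K chi h Z = None.
  by apply: the_eq_None => ZE extZ; apply: noext; exists ZE.
have -> // : extension kappa K chi h (ren C Z) = None.
apply: the_eq_None => ZE /(ren_H_extension kappa_gt0 (- C)); rewrite renK => extZ.
by apply: noext; exists (ren_H (- C) ZE).
Qed.
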